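(* Let $p$ be a prime and let $(A,+,\cdot)$ be a pre-Lie algebra over $\mathbb{F}_p$ with $(A,+)\cong C_p^5$, generated by two elements $x$ and $y$ (and by no fewer elements) as a pre-Lie algebra. Assume $A^{[3]}\neq 0$, $A^{[4]}=0$ and $\dim_{\mathbb{F}_p}A^{[3]}=1$. Put $S=\{x\cdot x,\ x\cdot y,\ y\cdot x,\ y\cdot y\}$. Then the following hold. (1) Not all elements of $S$ are in $A^{[3]}$. (2) $A$ has an $\mathbb{F}_p$-basis $\{x,y,u,v,w\}$ where $u,v\in S\setminus A^{[3]}$ and $w$ is of the form $c\cdot d$ with $c\in\{x,y\}$ and $d\in\{u,v\}$, or vice versa. (3) $A^{[2]}/A^{[3]}=\mathbb{F}_pu+\mathbb{F}_pv$ and $A^{[3]}=\mathbb{F}_pw$. (4) For $i,j\in\{x,y\}$ write $i\cdot j=\alpha_{ij}u+\beta_{ij}v+\gamma_{ij}w$ with $\alpha_{ij},\beta_{ij},\gamma_{ij}\in\mathbb{F}_p$; then not all pairs $(\alpha_{ij},\beta_{ij})$ are $(0,0)$. For $k\in\{x,y\}$ and $l\in\{u,v\}$, or vice versa, write $k\cdot l=\delta_{kl}w$ with $\delta_{kl}\in\mathbb{F}_p$. Then $$\alpha_{xy}\delta_{ux}+\beta_{xy}\delta_{vx}-\alpha_{yx}\delta_{xu}-\beta_{yx}\delta_{xv}=\alpha_{yx}\delta_{ux}+\beta_{yx}\delta_{vx}-\alpha_{xx}\delta_{yu}-\beta_{xx}\delta_{yv},$$ $$\alpha_{yx}\delta_{uy}+\beta_{yx}\delta_{vy}-\alpha_{xy}\delta_{yu}-\beta_{xy}\delta_{yv}=\alpha_{xy}\delta_{uy}+\beta_{xy}\delta_{vy}-\alpha_{yy}\delta_{xu}-\beta_{yy}\delta_{xv}.$$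 (5) Conversely, if $A$ is a five-dimensional $\mathbb{F}_p$-vector space with a bilinear product (not assumed to be pre-Lie) generated by $x,y$, with $A^{[3]}\ne0$, $A^{[4]}=0$, $\dim_{\mathbb{F}_p}A^{[3]}=1$, and satisfying (1)–(4), then $A$ is a well defined pre-Lie algebra.
   Context: A pre-Lie algebra over $\mathbb{F}_p$ is an $\mathbb{F}_p$-vector space $A$ with a bilinear product $\cdot$ satisfying $(a\cdot b)\cdot c-a\cdot(b\cdot c)=(b\cdot a)\cdot c-b\cdot(a\cdot c)$ for all $a,b,c\in A$. For subspaces $B,C\subseteq A$, $B\cdot C$ denotes the subspace spanned by all $b\cdot c$ with $b\in B$, $c\in C$. Define (for any bilinear product) $A^{[1]}=A$ and $A^{[i+1]}=\sum_{j=1}^{i}A^{[j]}\cdot A^{[i+1-j]}$ for $i\ge 1$. $A^{[2]}/A^{[3]}=\mathbb{F}_pu+\mathbb{F}_pv$ means the quotient is spanned by the images of $u$ and $v$. *)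

(* Defs.v *)
From HB Require Import structures.
From mathcomp Require Export all_boot all_order all_algebra.

Set Implicit Arguments.
Unset Strict Implicit.
Unset Printing Implicit Defensive.

Import GRing.Theory.
Local Open Scope ring_scope.

Section NonAssociative.

Variables (F : fieldType) (A : vectType F) (mul : {bilinear A -> A -> A}).
Implicit Types (U V W : {vspace A}) (x y u v w : A).

Local Notation "a · b" := (mul a b) (at level 40, left associativity).

Definition is_preLie : Prop :=
  forall a b c : A,
    (a · b) · c - a · (b · c) = (b · a) · c - b · (a · c).

(* Spanning by products of basis vectors, as for prodv in falgebra; mulvP below
   shows that this is the span of all products u · v with u in U, v in V. *)
Definition mulv U V : {vspace A} := <<allpairs mul (vbasis U) (vbasis V)>>%VS.

Lemma memv_mulv U V : {in U & V, forall u v, u · v \in mulv U V}.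
Proof.
move=> u v /coord_vbasis-> /coord_vbasis->.
rewrite linear_sumlz /= memv_suml // => i _.
rewrite linear_sumr /= memv_suml // => j _.
rewrite linearZl_LR linearZr_LR !memvZ // memv_span //.
by apply/allpairsP; exists ((vbasis U)`_i, (vbasis V)`_j); rewrite !memt_nth.
Qed.

Lemma mulvP U V W :
  reflect {in U & V, forall u v, u · v \in W} (mulv U V <= W)%VS.
Proof.
apply: (iffP idP) => [sUVW u v Uu Vv | sUVW].
  by apply: (subvP sUVW); apply: memv_mulv.
apply/span_subvP=> _ /allpairsP[[u v] /= [Uu Vv ->]].
by rewrite sUVW ?vbasis_mem.
Qed.

(* A^[i], by course-of-values recursion with fuel k; any k >= i gives the same
   value, and apow1 and apowS below are the defining equations.  Indices start
   at 1; A^[0] is a junk value. *)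
Fixpoint apow_rec (k i : nat) {struct k} : {vspace A} :=
  if k is k'.+1 then
    if (i <= 1)%N then fullv
    else (\sum_(1 <= j < i) mulv (apow_rec k' j) (apow_rec k' (i - j)))%VS
  else fullv.

Definition apow (i : nat) : {vspace A} := apow_rec i i.

Lemma apow_rec_fuel k l i :
  (i <= k)%N -> (i <= l)%N -> apow_rec k i = apow_rec l i.
Proof.
elim: k l i => [|k IHk] [|l] i //=; first by case: i.
  by case: i.
move=> le_ik le_il; case: ifP => // _.
apply: eq_big_nat => j /andP[j_gt0 lt_ji].
have le_k m : (m < i)%N -> (m <= k)%N by move=> h; rewrite -ltnS (leq_trans h).
have le_l m : (m < i)%N -> (m <= l)%N by move=> h; rewrite -ltnS (leq_trans h).
have lt_iji : (i - j < i)%N by rewrite ltn_subrL j_gt0 (leq_trans _ lt_ji).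
by rewrite (IHk l j) ?(IHk l (i - j)%N) ?le_k ?le_l.
Qed.

Lemma apow1 : apow 1 = fullv. Proof. by []. Qed.

Lemma apowS i : (1 <= i)%N ->
  apow i.+1 = (\sum_(1 <= j < i.+1) mulv (apow j) (apow (i.+1 - j)))%VS.
Proof.
move=> i_gt0; rewrite /apow /= ltnNge i_gt0 /=.
apply: eq_big_nat => j /andP[j_gt0 le_ji].
have le_ij : (i.+1 - j <= i)%N by rewrite leq_subLR -add1n leq_add2r.
by rewrite (@apow_rec_fuel i j j) ?(@apow_rec_fuel i (i.+1 - j) (i.+1 - j)).
Qed.

Definition generates (X : seq A) : Prop :=
  forall U, {subset X <= U} -> {in U &, forall a b, a · b \in U} -> U = fullv.

(* The images of the vectors of X lie in, and span, the quotient U / W. *)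
Definition spans_quotient (U W : {vspace A}) (X : seq A) : Prop :=
  [/\ (W <= U)%VS, {subset X <= U} &
      forall a, a \in U -> exists2 b, b \in <<X>>%VS & a - b \in W].

Definition gen_products x y : seq A := [:: x · x; x · y; y · x; y · y].

Definition products_not_all_deep x y : Prop :=
  ~ {subset gen_products x y <= apow 3}.

Definition adapted_basis x y u v w : Prop :=
  [/\ basis_of fullv [:: x; y; u; v; w],
      u \in gen_products x y /\ u \notin apow 3,
      v \in gen_products x y /\ v \notin apow 3 &
      exists c d : A,
        ((c \in [:: x; y]) && (d \in [:: u; v])
         || (c \in [:: u; v]) && (d \in [:: x; y])) /\ w = c · d].

Definition layers_spanned u v w : Prop :=
  spans_quotient (apow 2) (apow 3) [:: u; v] /\ apow 3 = <[w]>%VS.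

(* The coefficients are indexed by the elements of A themselves; only their
   values on x, y (resp. on one of x, y and one of u, v) matter. *)
Definition structure_constants x y u v w : Prop :=
  exists alpha beta gamma delta : A -> A -> F,
    [/\ {in [:: x; y] &, forall i j,
           i · j = alpha i j *: u + beta i j *: v + gamma i j *: w},
        ~ {in [:: x; y] &, forall i j, (alpha i j, beta i j) = (0, 0)},
        {in [:: x; y] & [:: u; v], forall k l, k · l = delta k l *: w}
        /\ {in [:: u; v] & [:: x; y], forall k l, k · l = delta k l *: w},
        alpha x y * delta u x + beta x y * delta v x
          - alpha y x * delta x u - beta y x * delta x v
        = alpha y x * delta u x + beta y x * delta v x
          - alpha x x * delta y u - beta x x * delta y v &
        alpha y x * delta u y + beta y x * delta v y
          - alpha x y * delta y u - beta x y * delta y v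
        = alpha x y * delta u y + beta x y * delta v y
          - alpha y y * delta x u - beta y y * delta x v].

End NonAssociative.

(* Main.v *)
Require Import Defs.
From mathcomp Require Import all_boot all_order all_algebra.
From mathcomp Require Import ring.
Import GRing.Theory.
Local Open Scope ring_scope.

(** Write A_i for A^[i]; then A_i A_j is contained in A_(i+j).  If X generates
    A, then A is spanned by X modulo A_2, hence A_2 is spanned by the products
    of two elements of X modulo A_3 (apow2_span), and if moreover A_4 = 0 and
    A_2 is spanned by Y modulo A_3, then A_3 is spanned by the products of an
    element of X and an element of Y, in either order (apow3_eq0 is the part of
    this that is used).  All of this holds for any bilinear product.

    Dimensions.  Two generators give dim A/A_2 <= 2.  A complement of A_2 of
    dimension c yields dim A_2/A_3 <= c^2 (dim_apow2_le), so with dim A = 5 and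
    dim A_3 = 1 the only possibility is c = 2 and dim A_2 = 3.  Thus A_2/A_3 is
    a plane spanned by the images of the products xx, xy, yx, yy: two of these,
    u and v, form a basis of it, and some product w of one of x, y with one of
    u, v is nonzero and spans the line A_3.

    Pre-Lie identity.  The defect D(a, b, c) = (ab)c - a(bc) - (ba)c + b(ac) is
    trilinear, antisymmetric in a and b, and, as A_4 = 0, vanishes as soon as
    one argument lies in A_2.  As A = <x, y> + A_2, the identity therefore
    amounts to D(x, y, x) = 0 and D(y, x, y) = 0 (preLie_two_generators).  In
    the coordinates given by u, v, w these two defects are multiples of w, and
    the coefficients are the differences of the two sides of the two displayed
    equations (preLie_defect_coord).  This gives both the necessity and the
    sufficiency of the equations. *)

Section BilinearProduct.

Set Implicit Arguments.
Unset Strict Implicit.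
Unset Printing Implicit Defensive.

Variables (F : fieldType) (A : vectType F) (mul : {bilinear A -> A -> A}).
Implicit Types (U V W : {vspace A}) (X Y : seq A) (a b c u v w x y : A).

Local Notation "a · b" := (mul a b) (at level 40, left associativity).
Local Notation A_ i := (apow mul i).

(** * Spans and products *)

(** A span induction for arbitrary properties, not only for membership in a
    subspace: it is also applied to the vanishing of a linear map. *)
Lemma span_elim (P : A -> Prop) X :
    P 0 -> (forall k a b, P a -> P b -> P (k *: a + b)) ->
  {in X, forall a, P a} -> {in <<X>>%VS, forall a, P a}.
Proof.
move=> P0 PL PX a /(coord_span (X := in_tuple X))->.
elim/big_rec: _ => // i b _ Pb; apply: PL => //.
exact/PX/mem_nth.
Qed.

Lemma mem_mul_span X Y W :
  {in X & Y, forall a b, a · b \in W} ->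
  {in <<X>>%VS & <<Y>>%VS, forall a b, a · b \in W}.
Proof.
move=> XYW a b Xa Yb; move: a Xa; apply: span_elim => [|k a a' Wa Wa'|a Xa].
- by rewrite linear0l mem0v.
- by rewrite linearPl memvD ?memvZ.
move: b Yb; apply: span_elim => [|k b b' Wb Wb'|b Yb]; last exact: XYW.
- by rewrite linear0r mem0v.
- by rewrite linearPr memvD ?memvZ.
Qed.

(** * The first four powers *)

Lemma memv_mul_apow i j a b : (0 < i)%N -> (0 < j)%N ->
  a \in A_ i -> b \in A_ j -> a · b \in A_ (i + j).
Proof.
case: i => // i _; case: j => // j _ Aa Ab.
rewrite addSn apowS ?addnS //.
(* The product lies in the summand A_(i+1) A_(j+1) of A_(i+j+2). *)
rewrite (bigD1_seq i.+1) ?iota_uniq ?mem_index_iota ?ltnS ?leq_addr //=.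
apply: (subvP (addvSl _ _)).
by rewrite -addSn -addnS addKn memv_mulv.
Qed.

Lemma apow2E : A_ 2 = mulv mul fullv fullv.
Proof. by rewrite apowS // big_nat1. Qed.

Lemma apow3E : A_ 3 = (mulv mul fullv (A_ 2) + mulv mul (A_ 2) fullv)%VS.
Proof. by rewrite apowS // big_nat_recr //= big_nat1. Qed.

Lemma apow3_sub2 : (A_ 3 <= A_ 2)%VS.
Proof.
rewrite apow3E apow2E subv_add.
by apply/andP; split; apply/mulvP => a b _ _; rewrite memv_mulv ?memvf.
Qed.

Lemma mul_memv2 a b : a · b \in A_ 2.
Proof. by apply: (@memv_mul_apow 1 1); rewrite ?memvf. Qed.

Lemma mul_memv3l a b : b \in A_ 2 -> a · b \in A_ 3.
Proof. by apply: (@memv_mul_apow 1 2); rewrite ?memvf. Qed.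

Lemma mul_memv3r a b : a \in A_ 2 -> a · b \in A_ 3.
Proof. by move=> Aa; apply: (@memv_mul_apow 2 1); rewrite ?memvf. Qed.

Lemma mul_memv4 a b : a \in A_ 2 -> b \in A_ 2 -> a · b \in A_ 4.
Proof. exact: (@memv_mul_apow 2 2). Qed.

Lemma mul_memv4l a b : b \in A_ 3 -> a · b \in A_ 4.
Proof. by apply: (@memv_mul_apow 1 3); rewrite ?memvf. Qed.

Lemma mul_memv4r a b : a \in A_ 3 -> a · b \in A_ 4.
Proof. by move=> Aa; apply: (@memv_mul_apow 3 1); rewrite ?memvf. Qed.

(** The subspace <X> + A_2 contains X, and it is closed under products because
    it contains A_2. *)
Lemma generates_mod_apow2 X : generates mul X -> (<<X>> + A_ 2)%VS = fullv.
Proof.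
move=> genX; apply: genX => [a Xa|a b _ _]; last first.
  exact: (subvP (addvSr _ _)) (mul_memv2 a b).
exact/(subvP (addvSl _ _))/memv_span.
Qed.

(** Expanding (a1 + a2)(b1 + b2) with a1, b1 in <X> and a2, b2 in A_2, all terms
    but a1 b1 lie in A_3. *)
Lemma apow2_span X : (<<X>> + A_ 2)%VS = fullv ->
  A_ 2 = (<<allpairs mul X X>> + A_ 3)%VS.
Proof.
move=> genX; apply/eqP; rewrite eqEsubv subv_add apow3_sub2 andbT.
apply/andP; split; last first.
  by apply/span_subvP=> _ /allpairsP[[a b] /= [_ _ ->]]; apply: mul_memv2.
rewrite {1}apow2E; apply/mulvP=> a b.
rewrite -genX => /memv_addP[a1 Xa1 [a2 Aa2 ->]] /memv_addP[b1 Xb1 [b2 Ab2 ->]].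
rewrite linearDl /= linearDr /= -addrA memv_add //.
  move: a1 b1 Xa1 Xb1 {a b a2 b2 Aa2 Ab2}; apply: mem_mul_span => a b Xa Xb.
  by apply/memv_span/allpairsP; exists (a, b).
by apply: memvD; [apply: mul_memv3l | apply: mul_memv3r].
Qed.

(** The products of X and Y span A_3 modulo A_4.  The lemma is the case where
    they all vanish, which is what provides a nonzero w. *)
Lemma apow3_eq0 X Y : (<<X>> + A_ 2)%VS = fullv -> A_ 2 = (<<Y>> + A_ 3)%VS ->
    A_ 4 = 0%VS ->
    {in X & Y, forall a b, a · b = 0} -> {in Y & X, forall b a, b · a = 0} ->
  A_ 3 = 0%VS.
Proof.
move=> genX genY A4 XY0 YX0; apply/eqP; rewrite -subv0 apow3E subv_add.
have XY a b : a \in <<X>>%VS -> b \in <<Y>>%VS -> a · b \in 0%VS.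
  by move: a b; apply: mem_mul_span => a b Xa Yb; rewrite XY0 ?mem0v.
have YX b a : b \in <<Y>>%VS -> a \in <<X>>%VS -> b · a \in 0%VS.
  by move: b a; apply: mem_mul_span => b a Yb Xa; rewrite YX0 ?mem0v.
apply/andP; split; apply/mulvP => a b.
  rewrite -genX => /memv_addP[a1 Xa1 [a2 Aa2 ->]] Ab.
  rewrite linearDl memvD //=; last by rewrite -A4 mul_memv4.
  move: Ab; rewrite genY => /memv_addP[b1 Yb1 [b2 Ab2 ->]].
  by rewrite linearDr memvD //=; [apply: XY | rewrite -A4 mul_memv4l].
move=> Aa; rewrite -genX => /memv_addP[b1 Xb1 [b2 Ab2 ->]].
rewrite linearDr memvD //=; last by rewrite -A4 mul_memv4.
move: Aa; rewrite genY => /memv_addP[a1 Ya1 [a2 Aa2 ->]].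
by rewrite linearDl memvD //=; [apply: YX | rewrite -A4 mul_memv4r].
Qed.

(** * Dimensions *)

(** A basis of a complement of A_2 spans A modulo A_2, so the products of its
    elements, whose number is the square of the codimension, span A_2 modulo
    A_3. *)
Lemma dim_apow2_le :
  (\dim (A_ 2) <= (\dim {:A} - \dim (A_ 2)) ^ 2 + \dim (A_ 3))%N.
Proof.
set X := vbasis (A_ 2)^C.
have genX : (<<X>> + A_ 2)%VS = fullv.
  by rewrite (span_basis (vbasisP _)) addvC addv_complf.
rewrite {1}(apow2_span genX) (leq_trans (dimv_add_leqif _ _)) // leq_add2r.
by rewrite (leq_trans (dim_span _)) // size_allpairs !size_tuple dimv_compl.
Qed.

(** With d = dim A_2, the two generators give 5 <= 2 + d and the previous bound
    gives d <= (5 - d)^2 + 1, which fails for d = 4 and d = 5. *)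
Lemma dim_apow2 x y : \dim {:A} = 5%N -> generates mul [:: x; y] ->
  \dim (A_ 3) = 1%N -> \dim (A_ 2) = 3%N.
Proof.
move=> dimA /generates_mod_apow2 genA dim3.
have := dim_apow2_le; rewrite dim3 dimA.
have := dimv_add_leqif <<[:: x; y]>> (A_ 2); rewrite genA dimA => -[+ _].
have := dim_span [:: x; y]; have := dimvS (subvf (A_ 2)); rewrite dimA /=.
by move: (\dim <<_>>) (\dim _) => m [|[|[|[|[|[|n]]]]]] //=; case: m => [|[|[|]]].
Qed.

(** * The pre-Lie defect *)

Definition preLie_defect a b c : A :=
  ((a · b) · c - a · (b · c)) - ((b · a) · c - b · (a · c)).

Lemma preLie_defectP : is_preLie mul <-> forall a b c, preLie_defect a b c = 0.
Proof.
split=> [preA a b c|defA a b c]; first by rewrite /preLie_defect preA subrr.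
by apply/eqP; rewrite -subr_eq0; apply/eqP/defA.
Qed.

Lemma preLie_defectC a b c : preLie_defect b a c = - preLie_defect a b c.
Proof. by rewrite /preLie_defect [RHS]opprB. Qed.

Fact linear_comb_sub k a b c d :
  (k *: a + b) - (k *: c + d) = k *: (a - c) + (b - d) :> A.
Proof. by rewrite scalerBr opprD addrACA. Qed.

Lemma preLie_defect_linear1 b c k a d :
  preLie_defect (k *: a + d) b c = k *: preLie_defect a b c + preLie_defect d b c.
Proof.
by rewrite /preLie_defect !(linearPl, linearPr) /= !linear_comb_sub.
Qed.

Lemma preLie_defect_linear3 a b k c d :
  preLie_defect a b (k *: c + d) = k *: preLie_defect a b c + preLie_defect a b d.
Proof.
by rewrite /preLie_defect !linearPr /= !linear_comb_sub.
Qed.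

(** Linearity in b comes from linearity in a by antisymmetry. *)
Lemma preLie_on_span X : <<X>>%VS = fullv ->
  (forall a b c, a \in X -> b \in X -> c \in X -> preLie_defect a b c = 0) ->
  is_preLie mul.
Proof.
move=> genX X0; apply/preLie_defectP=> a b c.
have span0 (f : A -> A) :
    (forall k a b, f (k *: a + b) = k *: f a + f b) ->
  {in X, forall a, f a = 0} -> forall a, f a = 0.
  move=> lin_f fX d; have: d \in <<X>>%VS by rewrite genX memvf.
  move: d; apply: span_elim => // [|k d e fd fe]; last first.
    by rewrite lin_f fd fe scaler0 addr0.
  by have := lin_f (-1) 0 0; rewrite scaler0 addr0 scaleN1r addNr.
move: a; apply: (span0 _) => [k d e|a Xa]; first exact: preLie_defect_linear1.
apply: oppr_inj; rewrite oppr0 -preLie_defectC.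
move: b; apply: (span0 _) => [k d e|b Xb]; first exact: preLie_defect_linear1.
move: c; apply: (span0 _) => [k d e|c Xc]; first exact: preLie_defect_linear3.
exact: X0.
Qed.

(** An element of A_2 multiplied by two elements of A in any arrangement lands
    in A_4. *)
Lemma preLie_defect_apow2 a b c : A_ 4 = 0%VS ->
  [|| a \in A_ 2, b \in A_ 2 | c \in A_ 2] -> preLie_defect a b c = 0.
Proof.
move=> A4.
have eq0 d : d \in A_ 4 -> d = 0 by rewrite A4 memv0 => /eqP.
have defect1 d e f : d \in A_ 2 -> preLie_defect d e f = 0.
  move=> Ad; apply: eq0; rewrite /preLie_defect !memvB //.
  - exact/mul_memv4r/mul_memv3r.
  - by rewrite mul_memv4 ?mul_memv2.
  - exact/mul_memv4r/mul_memv3l.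
  - exact/mul_memv4l/mul_memv3r.
case/or3P=> [Aa|Ab|Ac]; first exact: defect1.
  by rewrite preLie_defectC defect1 ?oppr0.
apply: eq0; rewrite /preLie_defect !memvB //; try by rewrite mul_memv4 ?mul_memv2.
- exact/mul_memv4l/mul_memv3l.
- exact/mul_memv4l/mul_memv3l.
Qed.

(** On x, y and a basis of A_2 the defect vanishes for trivial reasons except
    when the first two arguments are x and y; then the third one is x or y. *)
Lemma preLie_two_generators x y : generates mul [:: x; y] -> A_ 4 = 0%VS ->
  is_preLie mul <-> preLie_defect x y x = 0 /\ preLie_defect y x y = 0.
Proof.
move=> gen A4; split=> [/preLie_defectP preA|[xyx yxy]]; first by rewrite !preA.
apply: (@preLie_on_span ([:: x; y] ++ vbasis (A_ 2))).
  by rewrite span_cat (span_basis (vbasisP _)); apply: generates_mod_apow2.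
have [xyy yxx] : preLie_defect x y y = 0 /\ preLie_defect y x x = 0.
  by split; rewrite preLie_defectC ?xyx ?yxy oppr0.
have diag a b : preLie_defect a a b = 0 by rewrite /preLie_defect subrr.
move=> a b c; rewrite !mem_cat => /orP[Xa|/vbasis_mem Aa]; last first.
  by rewrite preLie_defect_apow2 ?Aa.
move=> /orP[Xb|/vbasis_mem Ab]; last by rewrite preLie_defect_apow2 ?Ab ?orbT.
move=> /orP[Xc|/vbasis_mem Ac]; last by rewrite preLie_defect_apow2 ?Ac ?orbT.
move: Xa Xb Xc; rewrite !inE.
by do 3![case/orP=> /eqP->].
Qed.

(** The terms in gamma disappear since w multiplies A into A_4 = 0.  The lemma
    is used for (i, j) = (x, y) and (y, x); X = [:: x; y] covers both. *)
Lemma preLie_defect_coord u v w X i j (alpha beta gamma delta : A -> A -> F) :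
    A_ 4 = 0%VS -> w \in A_ 3 ->
    {in X &, forall k l,
       k · l = alpha k l *: u + beta k l *: v + gamma k l *: w} ->
    {in X & [:: u; v], forall k l, k · l = delta k l *: w} ->
    {in [:: u; v] & X, forall k l, k · l = delta k l *: w} ->
    i \in X -> j \in X ->
  preLie_defect i j i =
    ((alpha i j * delta u i + beta i j * delta v i
          - alpha j i * delta i u - beta j i * delta i v)
     - (alpha j i * delta u i + beta j i * delta v i
          - alpha i i * delta j u - beta i i * delta j v)) *: w.
Proof.
move=> A4 Aw prodE prodl prodr Xi Xj; rewrite /preLie_defect.
have w0 a : w · a = 0 /\ a · w = 0.
  split; apply/eqP; rewrite -memv0 -A4; first exact: mul_memv4r.
  exact: mul_memv4l.
rewrite (prodE i j) ?(prodE j i) ?(prodE i i) ?inE ?eqxx ?orbT //.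
rewrite !linearDl !linearDr /= !linearZl_LR !linearZr_LR /=.
rewrite !(w0 _).1 !(w0 _).2 !scaler0 !addr0.
rewrite !(prodr u) ?(prodr v) ?(prodl i) ?(prodl j) ?inE ?eqxx ?orbT //.
by rewrite !scalerA -!scalerDl -!scalerBl; congr (_ *: w); ring.
Qed.

(** * Adapted bases *)

Lemma dim_add_line U a : a \notin U -> \dim (<[a]> + U) = (\dim U).+1.
Proof.
move=> Ua; have a0: a != 0 by apply: contraNneq Ua => ->; apply: mem0v.
rewrite dimv_disjoint_sum ?dim_vline ?a0 //; apply/eqP; rewrite -subv0.
apply/subvP=> b; rewrite memv_cap => /andP[/vlineP[k ->]].
by rewrite rpredZeq (negPf Ua) orbF memv0 => /eqP->; rewrite scale0r.
Qed.

Lemma span_add_nsub X U W : (U <= W)%VS -> ~~ (<<X>> + U <= W)%VS ->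
  exists2 a, a \in X & a \notin W.
Proof.
move=> sUW; rewrite subv_add sUW andbT => /negP nsub; apply/hasP.
rewrite has_predC; apply/negP=> /allP XW; exact/nsub/span_subvP.
Qed.

Lemma dim1_line U a : \dim U = 1%N -> a \in U -> a != 0 -> U = <[a]>%VS.
Proof.
move=> dimU Ua a0; apply/esym/eqP.
by rewrite eqEdim -memvE Ua dimU dim_vline a0.
Qed.

Lemma gen_products_apow2 x y : {subset gen_products mul x y <= A_ 2}.
Proof. by move=> s; rewrite !inE => /or4P[] /eqP->; apply: mul_memv2. Qed.

Lemma mixed_product_apow3 x y u v c d : u \in A_ 2 -> v \in A_ 2 ->
    (c \in [:: x; y]) && (d \in [:: u; v])
    || (c \in [:: u; v]) && (d \in [:: x; y]) ->
  c · d \in A_ 3.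
Proof.
move=> Au Av /orP[]/andP[].
  by move=> _; rewrite !inE => /orP[] /eqP->; apply: mul_memv3l.
by rewrite !inE => /orP[] /eqP-> _; apply: mul_memv3r.
Qed.

Lemma adapted_basis_mem x y u v w : adapted_basis mul x y u v w ->
  [/\ u \in A_ 2, v \in A_ 2 & w \in A_ 3].
Proof.
case=> _ [/gen_products_apow2 Au _] [/gen_products_apow2 Av _] [c [d [cd ->]]].
by split=> //; apply: mixed_product_apow3 cd.
Qed.

(** The vectors u, v, w are independent in A_2, which has dimension 3. *)
Lemma adapted_basis_layers x y u v w : \dim {:A} = 5%N ->
  generates mul [:: x; y] -> \dim (A_ 3) = 1%N -> adapted_basis mul x y u v w ->
  A_ 2 = <<[:: u; v; w]>>%VS /\ A_ 3 = <[w]>%VS.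
Proof.
move=> dimA gen dim3 basis; have [Au Av Aw] := adapted_basis_mem basis.
case: basis => /basis_free free5 _ _ _.
have free3 : free [:: u; v; w] by apply: (@catr_free _ _ [:: x; y]).
split; last first.
  by apply: dim1_line => //; apply: free_not0 free3 _; rewrite !inE eqxx !orbT.
apply/esym/eqP; rewrite eqEdim (dim_apow2 dimA gen dim3).
move: free3; rewrite /free /= => /eqP->; rewrite andbT.
apply/span_subvP => s; rewrite !inE => /or3P[] /eqP-> //.
exact: (subvP apow3_sub2).
Qed.

(** The images of the four products span the plane A_2 / A_3: u is chosen
    outside A_3, then v outside <u> + A_3, and w among the nonzero mixed
    products. *)
Lemma exists_adapted_basis x y : \dim {:A} = 5%N ->
    generates mul [:: x; y] -> \dim (A_ 3) = 1%N -> A_ 4 = 0%VS ->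
  exists u v w, adapted_basis mul x y u v w.
Proof.
move=> dimA gen dim3 A4.
have dim2 := dim_apow2 dimA gen dim3.
have genA := generates_mod_apow2 gen.
have A2S : A_ 2 = (<<gen_products mul x y>> + A_ 3)%VS by apply: apow2_span genA.
have [u Su nAu] : exists2 u, u \in gen_products mul x y & u \notin A_ 3.
  apply: span_add_nsub (subvv _) _; rewrite -A2S.
  by apply/negP=> /dimvS; rewrite dim2 dim3.
have [v Sv nAv] : exists2 v,
    v \in gen_products mul x y & v \notin (<[u]> + A_ 3)%VS.
  apply: span_add_nsub (addvSr _ _) _; rewrite -A2S.
  by apply/negP=> /dimvS; rewrite dim2 dim_add_line // dim3.
have [Au Av] := (gen_products_apow2 Su, gen_products_apow2 Sv).
have A2uv : A_ 2 = (<<[:: u; v]>> + A_ 3)%VS.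
  apply/esym/eqP; rewrite span_cons span_seq1 (addvC <[u]>%VS) -addvA eqEdim.
  by rewrite dim2 !dim_add_line ?dim3 // !subv_add apow3_sub2 -!memvE Au Av.
pose prods :=
  allpairs mul [:: x; y] [:: u; v] ++ allpairs mul [:: u; v] [:: x; y].
have /hasP[w prods_w nz_w] : has (predC1 0) prods.
  rewrite has_predC; apply/negP=> /allP prods0.
  suff A3 : A_ 3 = 0%VS by rewrite A3 dimv0 in dim3.
  apply: apow3_eq0 genA A2uv A4 _ _ => a b Xa Yb; apply/eqP/prods0;
    rewrite mem_cat.
    by rewrite allpairs_f.
  by rewrite orbC allpairs_f.
have prodE : exists c d : A,
    ((c \in [:: x; y]) && (d \in [:: u; v])
     || (c \in [:: u; v]) && (d \in [:: x; y])) /\ w = c · d.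
  move: prods_w; rewrite mem_cat.
  by case/orP=> /allpairsP[[c d] /= [Xc Yd ->]]; exists c, d; rewrite Xc Yd ?orbT.
have A3w : w \in A_ 3.
  by have [c [d [cd ->]]] := prodE; apply: mixed_product_apow3 cd.
exists u, v, w; split => //; last first.
- by split=> //; apply: contra nAv; apply/subvP/addvSr.
rewrite basisEdim dimA /= andbT (span_cat [:: x; y]) (span_cat [:: u; v]).
by rewrite span_seq1 -(dim1_line dim3 A3w nz_w) -A2uv genA.
Qed.

Lemma adapted_basis_structure x y u v w : \dim {:A} = 5%N ->
    generates mul [:: x; y] -> \dim (A_ 3) = 1%N -> A_ 4 = 0%VS ->
    is_preLie mul -> adapted_basis mul x y u v w ->
  layers_spanned mul u v w /\ structure_constants mul x y u v w.
Proof.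
move=> dimA gen dim3 A4 preA basis.
have [A2E A3E] := adapted_basis_layers dimA gen dim3 basis.
have A3w : w \in A_ 3 by rewrite A3E memv_line.
have uv2 a : a \in [:: u; v] -> a \in A_ 2.
  by move=> uva; rewrite A2E memv_span // (mem_cat _ [:: u; v] [:: w]) uva.
split.
  split=> //; split=> [|a uva|a].
  - exact: apow3_sub2.
  - exact: uv2.
  rewrite A2E (span_cat [:: u; v]) span_seq1 -A3E => /memv_addP[b uvb [c Ac ->]].
  by exists b => //; rewrite addrC addKr.
have w_neq0 : w != 0.
  by apply: contra_eq_neq dim3 => w0; rewrite A3E w0 dim_vline eqxx.
pose coeff (i : 'I_3) a b := coord [tuple u; v; w] i (a · b).
pose alpha := coeff ord0; pose beta := coeff (lift ord0 ord0).
pose gamma := coeff (lift ord0 (lift ord0 ord0)).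
pose delta a b := coord [tuple w] ord0 (a · b).
have prodE i j : i · j = alpha i j *: u + beta i j *: v + gamma i j *: w.
  have := mul_memv2 i j; rewrite A2E => /(coord_span (X := [tuple u; v; w])).
  by rewrite !big_ord_recl big_ord0 addr0 /= addrA.
have deltaE i j : i · j \in A_ 3 -> i · j = delta i j *: w.
  rewrite A3E -span_seq1 => /(coord_span (X := [tuple w])).
  by rewrite big_ord1.
have prodl : {in [:: x; y] & [:: u; v], forall k l, k · l = delta k l *: w}.
  by move=> k l _ uvl; apply/deltaE/mul_memv3l/uv2.
have prodr : {in [:: u; v] & [:: x; y], forall k l, k · l = delta k l *: w}.
  by move=> k l uvk _; apply/deltaE/mul_memv3r/uv2.
have /preLie_defectP defect0 := preA.
exists alpha, beta, gamma, delta; split=> //.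
- (* Otherwise u, being one of the four products, would be a multiple of w. *)
  move=> allzero; case: basis => _ [Su nAu] _ _; case/negP: nAu.
  have [i [j [Xi Xj ->]]] : exists i j,
      [/\ i \in [:: x; y], j \in [:: x; y] & u = i · j].
    have /allpairsP[[i j] /= [Xi Xj uE]] : u \in allpairs mul [:: x; y] [:: x; y].
      exact: Su.
    by exists i, j.
  have [a0 b0] := allzero i j Xi Xj.
  by rewrite prodE a0 b0 !scale0r !add0r memvZ.
- apply/eqP; rewrite -subr_eq0; apply/eqP.
  have := defect0 x y x.
  rewrite (preLie_defect_coord A4 A3w (in2W prodE) prodl prodr)
    ?inE ?eqxx ?orbT //.
  by move/eqP; rewrite scaler_eq0 (negPf w_neq0) orbF => /eqP.
- apply/eqP; rewrite -subr_eq0; apply/eqP.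
  have := defect0 y x y.
  rewrite (preLie_defect_coord A4 A3w (in2W prodE) prodl prodr)
    ?inE ?eqxx ?orbT //.
  by move/eqP; rewrite scaler_eq0 (negPf w_neq0) orbF => /eqP.
Qed.

Lemma structure_constants_preLie x y u v w :
    generates mul [:: x; y] -> A_ 4 = 0%VS -> adapted_basis mul x y u v w ->
  structure_constants mul x y u v w -> is_preLie mul.
Proof.
move=> gen A4 /adapted_basis_mem[_ _ A3w].
case=> alpha [beta [gamma [delta [prodE _ [prodl prodr] xyx yxy]]]].
have xX : x \in [:: x; y] by rewrite inE eqxx.
have yX : y \in [:: x; y] by rewrite !inE eqxx orbT.
apply/(preLie_two_generators gen A4).
by split; rewrite (preLie_defect_coord A4 A3w prodE prodl prodr) //
  ?xyx ?yxy subrr scale0r.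
Qed.

End BilinearProduct.

(** * The theorem *)

(** A bijection only compares cardinalities, but over a finite field these
    determine the dimension. *)
Lemma dim_bij (p n : nat) (A : vectType 'F_p) (f : A -> 'rV['F_p]_n) :
  prime p -> bijective f -> \dim {:A} = n.
Proof.
move=> p_prime bij_f.
have bij_r2v := Bijective (@VectorInternalTheory.r2vK _ A)
                          (@VectorInternalTheory.v2rK _ A).
have := bij_eq_card (bij_comp bij_f bij_r2v).
rewrite !card_mx !mul1n card_Fp // dimvf.
by move/eqP; rewrite eqn_exp2l ?prime_gt1 // => /eqP.
Qed.

Theorem theorem5p2p2 (p : nat) (p_prime : prime p) :
  (forall (A : vectType 'F_p) (mul : {bilinear A -> A -> A}) (x y : A),
     is_preLie mul ->
     (exists f : {additive A -> 'rV['F_p]_5}, bijective f) ->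
     generates mul [:: x; y] ->
     (forall X : seq A, generates mul X -> (2 <= size X)%N) ->
     apow mul 3 <> 0%VS ->
     apow mul 4 = 0%VS ->
     \dim (apow mul 3) = 1%N ->
     [/\ products_not_all_deep mul x y,
         exists u v w : A, adapted_basis mul x y u v w &
         forall u v w : A, adapted_basis mul x y u v w ->
           layers_spanned mul u v w /\ structure_constants mul x y u v w])
  /\
  (forall (A : vectType 'F_p) (mul : {bilinear A -> A -> A}) (x y : A),
     \dim {:A} = 5%N ->
     generates mul [:: x; y] ->
     apow mul 3 <> 0%VS ->
     apow mul 4 = 0%VS ->
     \dim (apow mul 3) = 1%N ->
     products_not_all_deep mul x y ->
     (exists u v w : A,
        [/\ adapted_basis mul x y u v w,
            layers_spanned mul u v w &
            structure_constants mul x y u v w]) ->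
     is_preLie mul).
Proof.
split=> A mul x y; last first.
  move=> _ gen _ A4 _ _ [u [v [w [basis _ constants]]]].
  exact: structure_constants_preLie gen A4 basis constants.
move=> preA [f bij_f] gen _ _ A4 dim3.
have dimA := dim_bij p_prime bij_f.
have exB := exists_adapted_basis dimA gen dim3 A4.
split=> // [|u v w basis]; last exact: adapted_basis_structure.
have [u [_ [_ [_ [Su /negP nAu] _ _]]]] := exB.
by move=> deep; apply/nAu/deep.
Qed.
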